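(* Let $K$ be a compact Hausdorff space and let $X=\{x_\alpha:\alpha<\omega_1\}\subset C_p(K)$ be a right-separated $\omega_1$-sequence. Then $X$ (with the subspace topology) is $\sigma$-discrete.
   Context: $C_p(K)$ is the set of all continuous functions $K\to\mathbb{R}$ with the topology of pointwise convergence (inherited from $\mathbb{R}^K$). A transfinite sequence $\{x_\alpha:\alpha<\lambda\}$ of (distinct) elements of a topological space is right-separated if for every $\mu<\lambda$ there is an open set $U$ such that $U\cap\{x_\alpha:\alpha<\lambda\}=\{x_\alpha:\alpha<\mu\}$. A space is $\sigma$-discrete if it is the union of countably many subspaces each of which is discrete in its relative topology. *)

(* Defs.v *)
From HB Require Import structures.
From mathcomp Require Import all_boot all_order all_algebra.
From mathcomp Require Import boolp classical_sets functions cardinality wochoice.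
From mathcomp Require Import reals topology normedtype.
Import Order.TTheory GRing.Theory Num.Theory.
Import numFieldNormedType.Exports.

Set Implicit Arguments.
Unset Strict Implicit.
Unset Printing Implicit Defensive.

Local Open Scope classical_set_scope.

Definition Cp (K : topologicalType) (R : realType) : Type :=
  @initial_topology (continuousType K R) {ptws K -> R} (fun f => (f : K -> R)).

HB.instance Definition _ (K : topologicalType) (R : realType) :=
  Topological.copy (Cp K R)
    (@initial_topology (continuousType K R) {ptws K -> R}
       (fun f => (f : K -> R))).

(* [W] has order type omega_1, the least uncountable ordinal: a well-order that
   is uncountable although all of its proper initial segments are countable.
   Elements of such a [W] play the role of the ordinals alpha < omega_1. *)
Definition order_type_omega1 (d : Order.disp_t) (W : orderType d) : Prop :=
  [/\ well_order (<=%O : rel W),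
      ~ countable [set: W] &
      forall mu : W, countable [set a : W | (a < mu)%O]].

Definition right_separated (d : Order.disp_t) (W : orderType d)
    (T : topologicalType) (x : W -> T) : Prop :=
  injective x /\
  forall mu : W, exists2 U : set T,
    open U & U `&` range x = x @` [set a | (a < mu)%O].

Definition discrete_space (T : topologicalType) : Prop :=
  forall A : set T, open A.

Definition sigma_discrete (T : topologicalType) : Prop :=
  exists2 D : nat -> set T,
    [set: T] = \bigcup_n D n & forall n, discrete_space (set_type (D n)).

(* Main.v *)
(* Right separation gives each x_a an open neighbourhood meeting X only in
   indices at most a; it contains a uniform ball of some radius 1/(n+1). Splitting
   X according to n, each piece X_n is 1/(n+1)-separated in the sup norm.

   Fix n and a small e. If, for all b < beta, x_b takes equal values at s and t
   while |x_a s - x_a t| >= e, then {g | g s != g t} is a pointwise open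
   neighbourhood of x_a that misses all those x_b. Taking beta as large as
   possible, x_b can lie in the neighbourhood chosen for x_a only if x_a varies by
   less than e on the common fibers of the x_b', b' <= b. By compactness this is
   already witnessed by finitely many b' and a positive tolerance; over a fixed
   witness x_a is determined up to 3e by its rounded values on a finite net of K,
   so separation leaves countably many such a in X_n. Intersecting with the
   neighbourhoods from right separation, the relation that x_b lies in the
   neighbourhood of x_a, on X_n, has countable rows and columns, hence a countable
   colouring whose classes are discrete. *)
Require Import Defs.
From HB Require Import structures.
From mathcomp Require Import all_boot all_order all_algebra.
From mathcomp Require Import finmap.
From mathcomp Require Import boolp classical_sets functions cardinality.
From mathcomp Require Import reals topology normedtype.
From mathcomp Require Import interval_inference lra.
Import Order.TTheory GRing.Theory Num.Theory.
Import numFieldNormedType.Exports.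
Set Implicit Arguments.
Unset Strict Implicit.
Unset Printing Implicit Defensive.
Local Open Scope classical_set_scope.
Local Open Scope ring_scope.

(* [compact_cover] requires a pointed space. *)
Lemma compact_cover_compact (T : topologicalType) (A : set T) :
  compact A -> cover_compact A.
Proof.
case: (pselect (A !=set0)) => [[p _]|A0] cA; last first.
  by move=> I D f _ _; exists fset0 => // t At; case: A0; exists t.
pose PT : ptopologicalType :=
  HB.pack (T : Type) T (isPointed.Build (T : Type) p).
by have := @compact_cover PT; rewrite predeqE => /(_ A)[+ _]; apply.
Qed.

(** * Oscillation on common fibers and its finite witnesses *)

Section Fibers.
Context {R : realType} {K : topologicalType} {W : choiceType}.
Variable f : W -> K -> R.
Hypotheses (cK : compact [set: K]) (cf : forall a, continuous (f a)).

(** A pair [(b, m)] stands for [f b] with tolerance [1/(m+1)]; such discrete tolerances leave only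
    countably many finite [F] over countably many [b]. *)
Definition fiber_close (F : set (W * nat)) (e : R) (a : W) :=
  forall s t, (forall p, F p -> `|f p.1 s - f p.1 t| < p.2.+1%:R^-1) ->
    `|f a s - f a t| < e.

Lemma continuous_osc a : continuous (fun z : K * K => `|f a z.1 - f a z.2|).
Proof.
move=> z; apply: cvg_norm; apply: cvgB.
- by apply: (@continuous_comp _ _ _ fst (f a)); [exact: cvg_fst | exact: cf].
- by apply: (@continuous_comp _ _ _ snd (f a)); [exact: cvg_snd | exact: cf].
Qed.

(** The open sets where [f a] oscillates by less than [e] (index [None]), or some [f b] with [b] in
    [D] by more than [1/(m+1)] (index [Some (b, m)]), cover [K * K]; a finite subcover yields
    [F]. *)
Lemma fiber_close_compact (D : set W) (e : R) (a : W) :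
  (forall s t, (forall b, D b -> f b s = f b t) -> `|f a s - f a t| < e) ->
  exists F, [/\ finite_set F, forall p, F p -> D p.1 & fiber_close F e a].
Proof.
move=> De.
pose I := option (W * nat)%type.
pose J : set I := [set i | if i is Some p then D p.1 else True].
pose g (i : I) : set (K * K) := if i is Some p then
  [set z | p.2.+1%:R^-1 < `|f p.1 z.1 - f p.1 z.2|]
  else [set z | `|f a z.1 - f a z.2| < e].
have og i : J i -> open (g i).
  case: i => [p|] _ /=.
    exact: (open_comp (fun z _ => @continuous_osc p.1 z) (@open_gt _ _)).
  exact: (open_comp (fun z _ => @continuous_osc a z) (@open_lt _ _)).
have gK : [set: K * K] `<=` cover J g.
  move=> [s t] _; case: (pselect (forall b, D b -> f b s = f b t)) => [Dst|].
    by exists None => //=; apply: De.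
  move=> /existsNP[b /not_implyP[Db /eqP bst]].
  have /ltr_add_invr[m] : 0 < `|f b s - f b t| by rewrite normr_gt0 subr_eq0.
  by rewrite add0r => mst; exists (Some (b, m)).
have cKK : compact [set: K * K] by rewrite -setXTT; exact: compact_setX.
have [D' D'J D'K] := compact_cover_compact cKK og gK.
exists [set p | Some p \in D']; split.
- rewrite (_ : [set p | _] = Some @^-1` [set` D'])//.
  by apply: finite_preimage => // p q _ _ [].
- by move=> p /D'J; rewrite inE.
- move=> s t st; have [//|[p|] /= pD'] := D'K (s, t) => //.
  by move=> /(lt_trans (st _ pD')); rewrite ltxx.
Qed.

Lemma finite_net (F : set (W * nat)) : finite_set F ->
  exists ts : seq K, forall s, exists2 t, t \in ts &
    forall p, F p -> `|f p.1 s - f p.1 t| < p.2.+1%:R^-1.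
Proof.
move=> fF.
pose N (t : K) := \bigcap_(p in F)
  [set s | `|f p.1 s - f p.1 t| < p.2.+1%:R^-1].
have NK : [set: K] `<=` cover setT (interior \o N).
  move=> t _; exists t => //; rewrite /interior /= /N.
  have [X ->] := finite_fsetP.1 fF; apply: filter_bigI => p _.
  have : f p.1 s @[s --> t] --> f p.1 t by exact: cf.
  by move=> /cvgr_distC_lt; apply; rewrite invr_gt0.
have oN t : [set: K] t -> open ((interior \o N) t).
  by move=> _; exact: open_interior.
have [ts _ tsK] := compact_cover_compact cK oN NK.
exists ts => s; have [//|t tts Nst] := tsK s; exists t => //.
exact: interior_subset Nst.
Qed.

Lemma eq_floor_close (u v : R) : Num.floor u = Num.floor v -> `|u - v| < 1.
Proof.
move=> uv; have := (ge_floor u, ge_floor v, floorD1_gt u, floorD1_gt v).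
rewrite uv ltr_norml => -[[[]]]; rewrite intrD; move: (_%:~R) => k ? ? ? ?.
by apply/andP; split; lra.
Qed.

(** Equal codes put [f a] and [f b] within [e] on the net; passing from [s] to a net point costs
    another [e] for each function. *)
Lemma countable_fiber_close (F : set (W * nat)) (e : R) (A : set W) :
  finite_set F -> 0 < e ->
  (forall a b, A a -> A b -> (forall s, `|f a s - f b s| < 3 * e) -> a = b) ->
  countable (A `&` fiber_close F e).
Proof.
move=> fF e0 sepA; have [ts tsP] := finite_net fF.
pose code a : seq int := [seq Num.floor (f a t / e) | t <- ts].
suff : {in A `&` fiber_close F e &, injective code}.
  move=> icode; apply/countable_injP; exists (choice.pickle \o code).
  by move=> a b aA bA /(pcan_inj choice.pickleK)/icode; apply.
move=> a b /set_mem[Aa Fa] /set_mem[Ab Fb] /eq_in_map ab.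
apply: sepA => // s; have [t tts st] := tsP s.
have := Fa _ _ st; have := Fb _ _ st.
have : `|f a t - f b t| < e.
  have := eq_floor_close (ab _ tts).
  by rewrite -mulrBl normrM normfV (gtr0_norm e0) ltr_pdivrMr// mul1r.
rewrite !ltr_norml => /andP[? ?] /andP[? ?] /andP[? ?].
by apply/andP; split; lra.
Qed.

End Fibers.

(** * Countable colourings and discrete pieces *)

(* Components of a graph with countable degrees are countable, so the vertices of
   each component can be numbered injectively. *)
Lemma countable_degree_coloring (T : Type) (E : T -> T -> Prop) :
  (forall a, countable [set b | E a b]) ->
  (forall b, countable [set a | E a b]) ->
  exists c : T -> nat, forall a b, E a b -> c a = c b -> a = b.
Proof.
move=> cE cE'.
pose nb a := [set b | E a b \/ E b a].
have cnb a : countable (nb a).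
  rewrite (_ : nb a = \bigcup_(i in [set: bool])
      if i then [set b | E a b] else [set b | E b a]).
    by apply: bigcup_countable => // -[] _; [exact: cE | exact: cE'].
  apply/seteqP; split => b /= => [[]|[[]]];
    by [exists true|exists false|left|right].
pose step (S : set T) := \bigcup_(b in S) nb b.
pose comp a := \bigcup_n iter n step [set a].
have ccomp a : countable (comp a).
  apply: bigcup_countable => // n _; elim: n => [|n IH] //=.
  exact: bigcup_countable.
have compS a b b' : comp a b -> nb b b' -> comp a b'.
  by move=> [n _ nb_] bb'; exists n.+1 => //=; exists b.
have comp_sub a b : nb a b -> comp b `<=` comp a.
  move=> ab t [n _]; elim: n t => [|n IH] t /=.
    by move=> ->; apply: compS ab; exists 0%N.
  by move=> [t' /IH at' /(compS _ _ _ at')].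
have comp_eq a b : E a b -> comp a = comp b.
  by move=> ab; apply/seteqP; split; apply: comp_sub; [right|left].
have inj (S : set T) : exists g : T -> nat, countable S -> {in S &, injective g}.
  case: (pselect (countable S)) => [/countable_injP[g ig]|nS]; first by exists g.
  (* Dummy value for uncountable [S], so that choice applies to all sets. *)
  by exists (fun _ => 0%N).
have [g gP] := choice inj.
have compxx a : comp a a by exists 0%N.
exists (fun a => g (comp a) a) => a b ab; rewrite -(comp_eq _ _ ab).
apply: gP => //; apply/mem_set => //.
by apply: compS (compxx a) _; left.
Qed.

Lemma sigma_discrete_coloring (T : topologicalType) (W : Type) (x : W -> T)
    (c : W -> nat) (U : W -> set T) :
  (forall a, open (U a)) -> (forall a, U a (x a)) ->
  (forall a b, c a = c b -> U a (x b) -> a = b) ->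
  sigma_discrete (set_type (range x)).
Proof.
move=> oU xU cU.
pose D n : set (set_type (range x)) :=
  [set p | exists2 a, c a = n & val p = x a].
exists D.
  apply/seteqP; split => // p _; have [a _ ap] := set_valP p.
  by exists (c a) => //; exists a.
move=> n A.
(* Each [U a] meets the colour class of [a] only in [x a], so this union cuts out exactly [A]. *)
pose V := \bigcup_(a in
  [set a | exists2 p, A p & val (val p) = x a /\ c a = n]) U a.
have oV : open V by apply: bigcup_open => a _; exact: oU.
exists (val @^-1` V); first by exists V.
apply/seteqP; split => [p [a [q Aq [qa can]] Uap]|p Ap].
  have [b cbn pb] := set_valP p.
  have ab : a = b by apply: cU; [rewrite can | move: Uap; rewrite /= pb].
  by rewrite (_ : p = q)//; apply: val_inj; apply: val_inj; rewrite qa ab.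
have [a can pa] := set_valP p.
by exists a; [exists p | rewrite /= pa].
Qed.

(** * Pointwise neighbourhoods and uniform balls *)

Section FunctionSpace.
Context {R : realType} {K : topologicalType}.

Definition cp_fun (g : Cp K R) : K -> R := (g : continuousType K R).

Lemma cp_fun_continuous (g : Cp K R) : continuous (cp_fun g).
Proof. exact: (@cts_fun _ _ (g : continuousType K R)). Qed.

Lemma eval_continuous (t : K) : continuous (fun g : Cp K R => cp_fun g t).
Proof.
move=> g.
have : {ptws, cp_fun @ nbhs g --> cp_fun g}.
  exact: (@initial_continuous (continuousType K R) {ptws K -> R}).
by move=> /pointwise_cvgP/(_ t).
Qed.

(** Otherwise functions outside [V] would converge to [g] uniformly, hence pointwise, and so enter
    [V]. *)
Lemma cp_open_uniform_ball (g : Cp K R) (V : set (Cp K R)) : open V -> V g ->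
  exists n, forall h, (forall s, `|cp_fun g s - cp_fun h s| < n.+1%:R^-1) -> V h.
Proof.
move=> oV Vg; apply: contrapT => /forallNP nV.
have /choice[h hP] : forall n, exists h : Cp K R,
    (forall s, `|cp_fun g s - cp_fun h s| < n.+1%:R^-1) /\ ~ V h.
  by move=> n; have /existsNP[h /not_implyP] := nV n; exists h.
have hg : {ptws, (cp_fun \o h) @ \oo --> cp_fun g}.
  apply/pointwise_cvgP => t.
  apply/cvgrPdist_lt => e e0.
  apply: filterS (near_infty_natSinv_lt (PosNum e0)) => n ne.
  exact: lt_trans ((hP n).1 t) ne.
have [B oB BV] : exists2 B : set {ptws K -> R}, open B & cp_fun @^-1` B = V.
  exact: oV.
have : nbhs (cp_fun g : {ptws K -> R}) B.
  by apply: open_nbhs_nbhs; split => //; move: Vg; rewrite -BV.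
move=> /hg [N _ NB]; have [_] := hP N; apply.
by rewrite -BV; exact: (NB N (leqnn N)).
Qed.

End FunctionSpace.

(** * Separation and closeness along the sequence *)

Section RightSeparated.
Context {R : realType} {K : topologicalType} {d : Order.disp_t} {W : orderType d}.
Variable x : W -> Cp K R.
Hypotheses (cK : compact [set: K]) (oW : order_type_omega1 W).
Hypothesis rs : right_separated x.

Let f a := cp_fun (x a).
Let cf a : continuous (f a). Proof. exact: cp_fun_continuous. Qed.

(** If nothing lay above [a], [W] would be a countable initial segment plus one point; [mu] is the
    least element above [a]. *)
Lemma omega1_succ (a : W) :
  exists2 mu, (a < mu)%O & forall b, (b < mu)%O -> (b <= a)%O.
Proof.
have [wo ucW cW] := oW.
have [|mu [[amu lemu] _]] := wo [pred b | (a < b)%O].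
  apply: contrapT => /forallNP na; apply: ucW.
  rewrite (_ : [set: W] = [set b | (b < a)%O] `|` [set a]).
    rewrite -bigcup2E; apply: bigcup_countable => // -[|[|n]] _ //=.
  apply/seteqP; split => // b _ /=; have /negP := na b.
  by rewrite inE -leNgt le_eqVlt => /orP[/eqP|]; [right|left].
exists mu => // b bmu; rewrite leNgt; apply/negP => ab.
by have := lemu b ab; rewrite leNgt bmu.
Qed.

Lemma countable_le (a : W) : countable [set b | (b <= a)%O].
Proof.
have [mu amu _] := omega1_succ a; have [_ _ /(_ mu)] := oW.
by apply: sub_countable; apply: subset_card_le => b /= /le_lt_trans; apply.
Qed.

Lemma right_separated_nbhs (a : W) : exists V : set (Cp K R),
  [/\ open V, V (x a) & forall b, V (x b) -> (b <= a)%O].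
Proof.
have [mu amu muP] := omega1_succ a; have [xI /(_ mu)[V oV VE]] := rs.
exists V; split => //.
  have : (x @` [set b | (b < mu)%O]) (x a) by exists a.
  by rewrite -VE => -[].
move=> b Vb; have : (V `&` range x) (x b) by split => //; exists b.
by rewrite VE => -[b' /= b'mu /xI <-]; exact: muP.
Qed.

(* Two indices in [ball_below n] whose functions are uniformly [1/(n+1)]-close
   lie below each other, hence coincide: this turns the order-theoretic
   hypothesis into separation in the norm. *)
Definition ball_below (n : nat) : set W :=
  [set a | forall b, (forall s, `|f a s - f b s| < n.+1%:R^-1) -> (b <= a)%O].

Lemma ball_below_cover (a : W) : exists n, ball_below n a.
Proof.
have [V [oV Va Vle]] := right_separated_nbhs a.
have [n nV] := cp_open_uniform_ball oV Va.
by exists n => b ab; apply: Vle; exact: nV.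
Qed.

Lemma ball_below_separated n a b : ball_below n a -> ball_below n b ->
  (forall s, `|f a s - f b s| < n.+1%:R^-1) -> a = b.
Proof.
move=> na nb ab; apply/le_anti/andP; split; last exact: na.
by apply: nb => s; rewrite distrC.
Qed.

(* By compactness this says that [f a] varies by less than [e] on each common
   fiber of the functions [f b'], [b' <= b], i.e. that it is close to the closed
   algebra they generate. *)
Definition close_over_le (e : R) (b : W) : set W := [set a | exists F,
  [/\ finite_set F, forall p, F p -> (p.1 <= b)%O & fiber_close f F e a]].

Lemma finite_set_bounded (P : set W) (F : set (W * nat)) : P !=set0 ->
  finite_set F -> (forall p, F p -> P p.1) ->
  exists2 b, P b & forall p, F p -> (p.1 <= b)%O.
Proof.
move=> [b0 Pb0] /finite_seqP[s ->].
elim: s => [|p s IH] sP; first by exists b0.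
have [|b Pb bP] := IH; first by move=> q qs; apply: sP; rewrite /= inE qs orbT.
exists (Order.max p.1 b).
  by rewrite /Order.max; case: ifP => // _; apply: sP; rewrite /= mem_head.
move=> q /=; rewrite inE => /orP[/eqP->|/bP qb].
  by rewrite le_max lexx.
by rewrite le_max qb orbT.
Qed.

(** [U] has to avoid [x b] for all [b] in [D]. If [f a] varies by less than [e] on the common fibers
    of [D], a finite witness has its indices below a single [b] in [D], contradicting the choice of
    [D]. Otherwise two points of one fiber separate [x a] from all these [x b]. *)
Lemma close_over_le_nbhs (e : R) (a : W) : 0 < e -> exists U : set (Cp K R),
  [/\ open U, U (x a) & forall b, U (x b) -> close_over_le e b a].
Proof.
move=> e0; pose D := [set b | ~ close_over_le e b a].
case: (pselect (D !=set0)) => [D0|nD]; last first.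
  exists setT; split => //; first exact: openT.
  by move=> b _; apply: contrapT => nb; apply: nD; exists b.
have [/(fiber_close_compact cK cf)|] := pselect (forall s t,
    (forall b, D b -> f b s = f b t) -> `|f a s - f a t| < e).
  move=> [F [fF FD Fa]]; have [b Db bF] := finite_set_bounded D0 fF FD.
  by case: Db; exists F.
move=> /existsNP[s /existsNP[t /not_implyP[st ast]]].
(* Every [f b] with [b] in [D] takes the same value at [s] and [t]. *)
exists [set g | cp_fun g s - cp_fun g t != 0]; split.
- have cst : continuous (fun g : Cp K R => cp_fun g s - cp_fun g t).
    move=> g.
    exact: cvgB (@eval_continuous _ _ s g) (@eval_continuous _ _ t g).
  exact: (open_comp (fun g _ => cst g) (@open_neq _ _)).
- apply/negP => /eqP ast0; apply: ast.
  by rewrite /f ast0 normr0.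
- move=> b /= bst; apply: contrapT => /st; rewrite /f => bst0.
  by move: bst; rewrite bst0 subrr eqxx.
Qed.

Lemma countable_close_over_le n b (e : R) : 0 < e -> 3 * e <= n.+1%:R^-1 ->
  countable (ball_below n `&` close_over_le e b).
Proof.
move=> e0 en.
pose C := [set p : W * nat | (p.1 <= b)%O].
have cC : countable C.
  rewrite (_ : C = [set b' | (b' <= b)%O] `*` [set: nat]).
    exact: countableX (countable_le b) _.
  by apply/seteqP; split => p //= [].
have := countable_finite_subset cC.
move=> /(@bigcup_countable _ _ _ (fun F => ball_below n `&` fiber_close f F e)) cF.
apply: sub_countable (cF _).
  apply: subset_card_le => a [na [F [fF Fb Fa]]].
  by exists F.
move=> F [_ fF]; apply: countable_fiber_close => // a a' na na' aa'.
by apply: ball_below_separated na na' _ => s; exact: lt_le_trans (aa' s) en.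
Qed.

Lemma ball_below_coloring n : exists (c : W -> nat) (U : W -> set (Cp K R)),
  [/\ forall a, open (U a), forall a, U a (x a) &
   forall a b, ball_below n a -> ball_below n b ->
     c a = c b -> U a (x b) -> a = b].
Proof.
pose e : R := n.+1%:R^-1 / 3.
(* The factor 3 matches the [3 * e] lost in rounding on a net. *)
have e0 : 0 < e by rewrite divr_gt0.
have /choice[U UP] : forall a, exists U : set (Cp K R), [/\ open U, U (x a) &
    forall b, U (x b) -> (b <= a)%O /\ close_over_le e b a].
  move=> a; have [V [oV Va Vle]] := right_separated_nbhs a.
  have [V' [oV' V'a V'le]] := close_over_le_nbhs a e0.
  exists (V `&` V'); split => //; first exact: openI.
  by move=> b [/Vle ? /V'le].
pose E a b := [/\ ball_below n a, ball_below n b & U a (x b)].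
(* Rows of [E] are countable by right separation, columns by closeness over [b]. *)
have [a|b|c cP] := @countable_degree_coloring W E.
- apply: sub_countable (countable_le a); apply: subset_card_le => b [_ _].
  by case: (UP a) => _ _ /[apply] -[].
- have : 3 * e <= n.+1%:R^-1 by rewrite mulrC divfK.
  move=> /(countable_close_over_le b e0); apply: sub_countable.
  apply: subset_card_le => a [na _ Uab]; split => //.
  by case: (UP a) => _ _ /(_ _ Uab)[].
exists c, U; split => [a|a|a b na nb cab Uab]; try by case: (UP a).
exact: cP.
Qed.

Lemma right_separated_sigma_discrete : sigma_discrete (set_type (range x)).
Proof.
have [N NP] := choice ball_below_cover.
have [c /choice[U cU]] := choice ball_below_coloring.
(* The colour also records the level [N a], so points of equal colour lie in one [ball_below n] and
   share its colouring. *)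
apply: (@sigma_discrete_coloring _ _ x
  (fun a => choice.pickle (N a, c (N a) a)) (fun a => U (N a) a)).
- by move=> a; have [oU _ _] := cU (N a); exact: oU.
- by move=> a; have [_ xU _] := cU (N a); exact: xU.
- move=> a b /(pcan_inj choice.pickleK)[Nab cab] Uab.
  have [_ _ UP] := cU (N a); apply: UP => //.
  + by rewrite Nab.
  + by rewrite cab Nab.
Qed.

End RightSeparated.

Theorem corollary1p6 (R : realType) (K : topologicalType)
    (d : Order.disp_t) (W : orderType d) (x : W -> Cp K R) :
  compact [set: K] -> hausdorff_space K ->
  order_type_omega1 W ->
  right_separated x ->
  sigma_discrete (set_type (range x)).
Proof. by move=> cK _; exact: right_separated_sigma_discrete. Qed.
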